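(* Let $(L,\le)$ be a dual algebraic coframe and let $\tau$ be an order-compatible topology on $L$. An element $x\in L$ is isolated in $(L,\tau)$ (i.e. $\{x\}\in\tau$) if and only if $x$ is dually compact, $x$ has no outcast, and the set $\mathcal{M}(x)$ of maximal subelements of $x$ is finite.
   Context: A filtered (resp. directed) set is a nonempty poset in which any two elements have a common lower (resp. upper) bound. An element $x$ of a poset $(L,\le)$ is dually compact if for every filtered $F\subset L$ having an infimum with $\bigwedge F\le x$ there is $f\in F$ with $f\le x$; $\mathcal{K}(L,\le)$ is the set of dually compact elements. A dual algebraic lattice is a lattice in which every subset has an infimum and every element $x$ equals $\bigwedge F_x$ for some filtered set $F_x\subset\mathcal{K}(L,\le)$. A coframe is a lattice in which every subset has an infimum and such that $x\vee\bigwedge_{s\in S}s=\bigwedge_{s\in S}(x\vee s)$ for all $x\in L$, $S\subset L$. A dual algebraic coframe is a poset that is both a dual algebraic lattice and a coframe. A net is a function $\boldsymbol{x}:D\to L$ with $D$ a directed set; it converges to $y$ if for every open $o\ni y$ there is $d\in D$ with $\boldsymbol{x}_{d'}\in o$ for all $d'\ge d$. A topology $\tau$ on $L$ is order-compatible when: (i) every non-increasing (resp. non-decreasing) net whose infimum (resp. supremum) exists converges to it; (ii) $\vee:L\times L\to L$ is continuous for $\tau\times\tau$ and $\tau$; (iii) $\le$ is a closed subset of $L\times L$. $\mathcal{M}(x)$ is the set of maximal elements of $\{z\in L: z<x\}$ (maximal subelements of $x$). An outcast of $x$ is an element $z<x$ which is not below any element of $\mathcal{M}(x)$. *)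

(* Defs.v *)
From HB Require Import structures.
From mathcomp Require Import all_boot all_order.
From mathcomp Require Import all_classical topology_structure product_topology.

Set Implicit Arguments.
Unset Strict Implicit.
Unset Printing Implicit Defensive.

Import Order.TTheory.
Local Open Scope classical_set_scope.
Local Open Scope order_scope.

(* The order and the topology are not assumed to be related. *)
#[short(type="latticeTopologicalType")]
HB.structure Definition LatticeTopological d :=
  { T of Topological T & Order.Lattice d T }.

Section Poset.
Context {d : Order.disp_t} {L : porderType d}.
Implicit Types (x y z : L) (A F : set L).

Definition filtered F :=
  F !=set0 /\
  forall x y, F x -> F y -> exists2 z, F z & z <= x /\ z <= y.

(* [infimums F m] reads: m is the infimum of F. *)
Definition dually_compact x :=
  forall F m, filtered F -> infimums F m -> m <= x ->
  exists2 f, F f & f <= x.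

Definition maximal_elements A : set L :=
  [set z | A z /\ forall w, A w -> z <= w -> w = z].

Definition maximal_subelements x : set L := maximal_elements [set z | z < x].

Definition outcast x z :=
  z < x /\ ~ (exists2 m, maximal_subelements x m & z <= m).

End Poset.

(* A may be empty, so that a complete L has a greatest element. *)
Definition has_all_infimums {d} (L : porderType d) :=
  forall A : set L, infimums A !=set0.

Definition dual_algebraic_lattice {d} (L : latticeType d) :=
  has_all_infimums L /\
  forall x : L, exists F : set L,
    [/\ filtered F, F `<=` dually_compact & infimums F x].

Definition coframe {d} (L : latticeType d) :=
  has_all_infimums L /\
  forall (x : L) (S : set L) (m : L), infimums S m ->
    infimums [set Order.join x s | s in S] (Order.join x m).

Definition dual_algebraic_coframe {d} (L : latticeType d) :=
  dual_algebraic_lattice L /\ coframe L.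

Definition directed_set {d} (D : porderType d) :=
  inhabited D /\ forall i j : D, exists k : D, i <= k /\ j <= k.

Definition net_cvg {d} {D : porderType d} {T : topologicalType}
    (u : D -> T) (y : T) :=
  forall o : set T, open o -> o y ->
  exists i : D, forall j : D, i <= j -> o (u j).

Definition order_compatible {d} (L : latticeTopologicalType d) :=
  [/\ forall (d' : Order.disp_t) (D : porderType d') (u : D -> L) (y : L),
        directed_set D -> {homo u : i j / i <= j >-> j <= i} ->
        infimums (range u) y -> net_cvg u y,
      forall (d' : Order.disp_t) (D : porderType d') (u : D -> L) (y : L),
        directed_set D -> {homo u : i j / i <= j >-> i <= j} ->
        supremums (range u) y -> net_cvg u y,
      continuous (fun p : L * L => Order.join p.1 p.2) &
      closed [set p : L * L | p.1 <= p.2]].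

(* Main.v *)
Require Import Defs.
From mathcomp Require Import all_boot all_order.
From mathcomp Require Import all_classical topology_structure product_topology.

(** Suppose first that [set x] is open.  A monotone net converging to [x] then
    takes the value [x].  Applied to a filtered set of dually compact elements
    with infimum [x], this makes [x] dually compact.  Applied to chains below
    [x], it keeps their suprema strictly below [x], so that Zorn's lemma puts
    every [z < x] below a maximal subelement.  If the set M of maximal
    subelements were infinite, the infima of its cofinite parts would form a
    directed set of elements [< x]; its supremum would be [< x], hence below
    some [m] in M, and in particular the infimum of the [w] in M other than [m]
    would be below [m].  The coframe law computes the join of [m] with that
    infimum as the infimum of the joins [m `|` w], which all equal [x]: so
    [x <= m], which is absurd.

    Conversely, when [x] has no outcast, [set x] is the down-set of [x] minus
    the down-sets of its maximal subelements.  Down-sets are closed, so with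
    finitely many maximal subelements it remains to show that the down-set of a
    dually compact [k] is open (dually_compact_down_open).  As joining with [k]
    is continuous, it is enough that this down-set be a neighbourhood of [k].

    This last fact is the heart of the proof: a small neighbourhood of [k] has
    a priori no good shape with respect to the order.  Continuity of the join
    at [(k, k)] gives, inside any neighbourhood of [k], sequences of open
    neighbourhoods U 0, U 1, ... with the joins of two elements of U n.+1
    lying in U n.  The core of such a sequence is the intersection of the
    closures of the U n: it is stable under joins and under monotone limits, so
    it contains its supremum.  If the down-set of [k] were not a neighbourhood
    of [k], each U n.+1 would contain some F n not below [k]; the upper limit
    of the F n lies in the core and, by dual compactness, is not below [k]
    (core_exceeds).  So no supremum of a core is below [k].  These suprema form
    a filtered set, since two sequences can be intersected; by dual compactness
    again, its infimum [m] is not below [k].  But [m] is adherent to every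
    neighbourhood of [k], which contradicts the closedness of the order. *)

Set Implicit Arguments.
Unset Strict Implicit.
Unset Printing Implicit Defensive.

Import Order.TTheory.
Local Open Scope classical_set_scope.

(** * Suprema and dual compactness *)

Section CompleteLattice.
Context {d : Order.disp_t} {L : porderType d}.
Implicit Types (A F : set L) (x k m : L).
Local Open Scope order_scope.

Definition directed A :=
  A !=set0 /\ forall x y, A x -> A y -> exists2 z, A z & x <= z /\ y <= z.

Lemma has_all_supremums A : has_all_infimums L -> supremums A !=set0.
Proof.
move=> /(_ (ubound A))[s [slb sub]]; exists s; split => [a Aa|//].
by apply: sub => u; exact.
Qed.

(** This contrapositive is how dual compactness is used throughout: it keeps
    limits of decreasing families away from the down-set of [k]. *)
Lemma dually_compact_inf_nle k F m : dually_compact k -> filtered F ->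
  infimums F m -> (forall f, F f -> ~ f <= k) -> ~ m <= k.
Proof. by move=> kc fF Fm Fk mk; have [f /Fk] := kc F m fF Fm mk. Qed.

End CompleteLattice.

(** * Monotone limits and joins in an order-compatible topology *)

Section OrderCompatible.
Context {d : Order.disp_t} {L : latticeTopologicalType d}.
Context (compatL : order_compatible L).
Implicit Types (A F O : set L) (x y k m : L).
Local Open Scope order_scope.

(** [F] itself, with the reversed order, indexes a non-increasing net. *)
Lemma filtered_inf_eventually F m O : filtered F -> infimums F m ->
  open O -> O m -> exists2 f, F f & forall g, F g -> g <= f -> O g.
Proof.
move=> [[f0 Ff0] Fdir] Fm Oo Om.
pose D : porderType _ := ((sub_type {x : L | x \in F}) : porderType d)^d.
have [netP _ _ _] := compatL.
pose toD f (Ff : F f) : D := exist _ f (mem_set Ff).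
have [|||i iO] := netP _ D (fun i : D => sval i) m _ _ _ O Oo Om.
- split; first exact: (inhabits (toD _ Ff0)).
  move=> i j; have [||h Fh [hi hj]] := Fdir (sval i) (sval j).
  + exact: set_mem (svalP i).
  + exact: set_mem (svalP j).
  + by exists (toD _ Fh).
- by move=> i j.
- rewrite (_ : range _ = F)//; apply/seteqP; split => [_ [i _ <-]|f Ff].
    exact: set_mem (svalP i).
  by exists (toD _ Ff).
- exists (sval i); first exact: set_mem (svalP i).
  by move=> g Fg gi; exact: (iO (toD _ Fg)).
Qed.

Lemma directed_sup_eventually A s O : directed A -> supremums A s ->
  open O -> O s -> exists2 a, A a & forall b, A b -> a <= b -> O b.
Proof.
move=> [[a0 Aa0] Adir] As Oo Os.
pose D : porderType _ := (sub_type {x : L | x \in A}) : porderType d.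
have [_ netP _ _] := compatL.
pose toD f (Af : A f) : D := exist _ f (mem_set Af).
have [|||i iO] := netP _ D (fun i : D => sval i) s _ _ _ O Oo Os.
- split; first exact: (inhabits (toD _ Aa0)).
  move=> i j; have [||h Ah [hi hj]] := Adir (sval i) (sval j).
  + exact: set_mem (svalP i).
  + exact: set_mem (svalP j).
  + by exists (toD _ Ah).
- by move=> i j.
- rewrite (_ : range _ = A)//; apply/seteqP; split => [_ [i _ <-]|f Af].
    exact: set_mem (svalP i).
  by exists (toD _ Af).
- exists (sval i); first exact: set_mem (svalP i).
  by move=> g Ag gi; exact: (iO (toD _ Ag)).
Qed.

(** [A] need not contain [F], nor a whole lower part of it.  This matters for
    the suprema of cores: below a given one, only some lie in a given core. *)
Lemma closure_coinitial_inf F m A : filtered F -> infimums F m ->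
  (forall f, F f -> exists2 g, F g & g <= f /\ A g) -> closure A m.
Proof.
move=> fF Fm FA B; rewrite nbhsE => -[O [Oo Om] OB].
have [f Ff fO] := filtered_inf_eventually fF Fm Oo Om.
by have [g Fg [gf Ag]] := FA _ Ff; exists g; split => //; exact/OB/fO.
Qed.

Lemma closure_directed_sup A s : directed A -> supremums A s -> closure A s.
Proof.
move=> dA As B; rewrite nbhsE => -[O [Oo Os] OB].
have [f Af fO] := directed_sup_eventually dA As Oo Os.
by exists f; split => //; apply/OB/fO.
Qed.

(** A Hausdorff property read off the closed order, one-sided so that it needs
    no case distinction between [y < x] and incomparable elements. *)
Lemma nle_separated x y : ~ x <= y ->
  exists P Q, [/\ nbhs x P, nbhs y Q & forall u, P u -> Q u -> False].
Proof.
have [_ _ _ cl] := compatL; move=> xy.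
have : nbhs (x, y) (~` [set p : L * L | p.1 <= p.2]).
  by apply: open_nbhs_nbhs; split => //; exact: closed_openC.
move=> [[P Q] /= [Px Qy] PQ]; exists P, Q; split => // u Pu Qu.
by apply: (PQ (u, u)) => /=.
Qed.

Lemma nbhs_join x y B : nbhs (x `|` y) B -> exists P Q,
  [/\ nbhs x P, nbhs y Q & forall p q, P p -> Q q -> B (p `|` q)].
Proof.
have [_ _ cj _] := compatL => nB.
have [[P Q] /= [Px Qy] PQ] := cj (x, y) B nB.
by exists P, Q; split => // p q Pp Qq; exact: (PQ (p, q)).
Qed.

Lemma closed_down x : closed [set z | z <= x].
Proof.
have [_ _ _ cl] := compatL; move=> z clz; apply: (cl (z, x)) => B /= [[P' Q'] /= [P'z Q'x] sB].
have [w [wx P'w]] := clz _ P'z.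
exists (w, x); split => //; apply: sB; split => //; exact: nbhs_singleton Q'x.
Qed.

(** * The down-set of a dually compact element is open *)

(** The name recalls the sequences of neighbourhoods of zero, each half the size
    of the one before, used to metrize a topological group. *)
Definition halving k (U : nat -> set L) := forall n,
  open_nbhs k (U n) /\ forall a b, U n.+1 a -> U n.+1 b -> U n (a `|` b).

Definition core (U : nat -> set L) : set L := \bigcap_n closure (U n).

(** Continuity of the join at [(k, k)], where [k `|` k = k], gives one halving
    step; dependent choice iterates it. *)
Lemma halving_exists k O : open_nbhs k O -> exists2 U, halving k U & U 0%N = O.
Proof.
move=> Ok.
have /choice[h hP] : forall W : set L, exists V, open_nbhs k W ->
    open_nbhs k V /\ forall a b, V a -> V b -> W (a `|` b).
  move=> W; have [kW|] := pselect (open_nbhs k W); last by exists set0.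
  have [|P [Q [Pk Qk PQ]]] := @nbhs_join k k W.
    by rewrite joinxx; exact: open_nbhs_nbhs.
  have : nbhs k (P `&` Q) by exact: filterI.
  rewrite nbhsE => -[V kV VPQ]; exists V => _; split => // a b Va Vb.
  by apply: PQ; [have [] := VPQ _ Va | have [] := VPQ _ Vb].
have hk n : open_nbhs k (iter n h O).
  by elim: n => // n IH; have [] := hP _ IH.
exists (fun n => iter n h O) => // n; split => //=.
by have [] := hP _ (hk n).
Qed.

Lemma halving_decr k U n : halving k U -> U n.+1 `<=` U n.
Proof. by move=> hU a Ua; rewrite -(joinxx a); apply: (hU n).2. Qed.

(** This makes the suprema of cores a filtered set. *)
Lemma halvingI k U V : halving k U -> halving k V ->
  halving k (fun n => U n `&` V n).
Proof.
move=> hU hV n; split; first exact: open_nbhsI (hU n).1 (hV n).1.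
by move=> a b [Ua Va] [Ub Vb]; split; [exact: (hU n).2|exact: (hV n).2].
Qed.

(** Halving moves the index by one, which the intersection over all indices
    absorbs. *)
Lemma core_join k U a b : halving k U ->
  core U a -> core U b -> core U (a `|` b).
Proof.
move=> hU Ca Cb n _ B /nbhs_join[P [Q [Pa Qb PQ]]].
have [p [Up Pp]] := Ca n.+1 I _ Pa; have [q [Uq Qq]] := Cb n.+1 I _ Qb.
by exists (p `|` q); split; [exact: (hU n).2|exact: PQ].
Qed.

Lemma core_center k U : halving k U -> core U k.
Proof. by move=> hU n _; apply/subset_closure; exact: (hU n).1.2. Qed.

Lemma core_sup k U s : halving k U -> supremums (core U) s -> core U s.
Proof.
move=> hU Us; have dU : directed (core U).
  split; first by exists k; exact: core_center.
  move=> a b Ca Cb; exists (a `|` b); first exact: core_join Ca Cb.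
  by rewrite leUl leUr.
move=> n _; apply: closed_closure.
by apply: closureS (closure_directed_sup dU Us) => c /(_ n I).
Qed.

(** The element found is the upper limit of a sequence F with F n in U n.+1
    and not below [k].  The join of F n, ..., F (n + p) lies in U n, however
    large p is: read from the right, each join costs one index.  Its limit in p
    is thus in the closure of U n, and the limit in n of these is in the core. *)
Lemma core_exceeds k U : has_all_infimums L -> dually_compact k ->
  halving k U -> ~ nbhs k [set z | z <= k] -> exists2 m, core U m & ~ m <= k.
Proof.
move=> infL kc hU nk.
have /choice[F FP] n : exists f, U n.+1 f /\ ~ f <= k.
  apply: contrapT => nf; apply: nk; rewrite nbhsE; exists (U n.+1).
    exact: (hU n.+1).1.
  by move=> z Uz; apply: contrapT => zk; apply: nf; exists z.
(* t n p is the join of F n, F n.+1, ..., F (n + p) *)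
pose fix t n p := if p is p'.+1 then F n `|` t n.+1 p' else F n.
have tU p n : U n (t n p).
  elim: p n => [|p IH] n /=; first exact/(halving_decr hU)/(FP n).1.
  by apply: (hU n).2; [exact: (FP n).1|exact: IH].
have t_mono n : {homo t n : p q / (p <= q)%N >-> p <= q}.
  move=> p q; elim: p q n => [|p IH] [|q] n //= pq; first by rewrite leUl.
  by rewrite leU2// IH.
have /choice[s sP] n : exists s, supremums (range (t n)) s.
  by have [s sP] := has_all_supremums (range (t n)) infL; exists s.
have sU n : closure (U n) (s n).
  have dt : directed (range (t n)).
    split; first by exists (t n 0%N), 0%N.
    move=> _ _ [p _ <-] [q _ <-]; exists (t n (maxn p q)).
      by exists (maxn p q).
    by split; apply: t_mono; rewrite ?leq_maxl ?leq_maxr.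
  by apply: closureS (closure_directed_sup dt (sP n)) => _ [p _ <-]; exact: tU.
have s_decr : {homo s : n p / (n <= p)%N >-> p <= n}.
  apply: (@homo_leq _ _ (fun x y => y <= x)) => // [y x z yx zy|n].
    exact: le_trans zy yx.
  apply: (sP n.+1).2 => _ [p _ <-].
  apply: (@le_trans _ _ (t n p.+1)); first by rewrite /= leUr.
  by apply: (sP n).1; exists p.+1.
have fs : filtered (range s).
  split; first by exists (s 0%N), 0%N.
  move=> _ _ [p _ <-] [q _ <-]; exists (s (maxn p q)); first by exists (maxn p q).
  by split; apply: s_decr; rewrite ?leq_maxl ?leq_maxr.
have [m mP] := infL (range s).
exists m; last first.
  apply: (dually_compact_inf_nle kc fs mP) => _ [n _ <-] snk.
  apply: (FP n).2; apply: le_trans snk.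
  by apply: (sP n).1; exists 0%N.
move=> n _; apply: closed_closure.
apply: (closure_coinitial_inf fs mP) => _ [p _ <-].
exists (s (maxn n p)); first by exists (maxn n p).
split; first by apply: s_decr; rewrite leq_maxr.
apply: closureS (sU (maxn n p)).
have : (n <= maxn n p)%N by rewrite leq_maxl.
move: (maxn n p); elim=> [|q IH]; first by rewrite leqn0 => /eqP->.
rewrite leq_eqVlt => /predU1P[->//|/IH nq].
exact: subset_trans (halving_decr hU) nq.
Qed.

(** The suprema of the cores decrease to an element which is adherent to every
    neighbourhood of [k] and yet, by dual compactness, not below [k]. *)
Lemma dually_compact_nbhs k : has_all_infimums L -> dually_compact k ->
  nbhs k [set z | z <= k].
Proof.
move=> infL kc; apply: contrapT => nk.
pose S := [set s | exists2 U, halving k U & supremums (core U) s].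
have S_below U s : halving k U -> S s ->
    exists2 s', S s' & s' <= s /\ core U s'.
  move=> hU [V hV Vs]; have hW := halvingI hV hU.
  have [s' s'P] := has_all_supremums (core (fun n => V n `&` U n)) infL.
  have cs' := core_sup hW s'P.
  exists s'; first by exists (fun n => V n `&` U n).
  split.
    apply: s'P.2 => c Cc; apply: Vs.1 => n _.
    by apply: closureS (Cc n I) => ? [].
  by move=> n _; apply: closureS (cs' n I) => ? [].
have fS : filtered S.
  split.
    have [U hU _] := halving_exists (open_nbhsT k).
    by have [s sP] := has_all_supremums (core U) infL; exists s, U.
  move=> s1 s2 Ss1 [U hU Us2]; have [s Ss [ss1 Us]] := S_below U s1 hU Ss1.
  by exists s => //; split => //; exact: Us2.1.
have [m mP] := infL S.
have : ~ m <= k.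
  apply: (dually_compact_inf_nle kc fS mP) => s [U hU Us] sk.
  have [c Cc ck] := core_exceeds infL kc hU nk.
  by apply: ck; apply: le_trans sk; exact: Us.1.
move=> /nle_separated[P [Q [Pm]]]; rewrite nbhsE => -[O Ok OQ] PQ.
have [U hU U0] := halving_exists Ok.
have : closure O m.
  apply: closed_closure; apply: (closure_coinitial_inf fS mP) => s Ss.
  have [s' Ss' [s's Cs']] := S_below U s hU Ss.
  by exists s' => //; split => //; rewrite -U0; exact: Cs'.
by move=> /(_ P Pm)[u [/OQ Qu Pu]]; exact: PQ Pu Qu.
Qed.

(** The map [w |-> w `|` k] is continuous and sends the down-set of [k] to [k];
    the preimage of a neighbourhood of [k] contained in the down-set is again
    contained in the down-set. *)
Lemma dually_compact_down_open k : has_all_infimums L -> dually_compact k ->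
  open [set z | z <= k].
Proof.
move=> infL kc; rewrite openE => z zk.
have := dually_compact_nbhs infL kc.
rewrite -{1}(join_r zk) => /nbhs_join[P [Q [Pz Qk PQ]]].
apply: filterS Pz => w Pw /=; rewrite leEjoin; apply/eqP/le_anti.
by rewrite leUr andbT; exact: (PQ w k Pw (nbhs_singleton Qk)).
Qed.

(** * Isolated elements *)

Lemma isolated_sup x A s : open [set x] -> directed A -> supremums A s ->
  (forall a, A a -> a < x) -> s < x.
Proof.
move=> xo dA As Ax; rewrite lt_neqAle; apply/andP; split; last first.
  by apply: As.2 => a /Ax/ltW.
apply/eqP => sx; have [|a Aa ao] := directed_sup_eventually dA As xo.
  by rewrite sx.
by have := Ax _ Aa; rewrite (ao a Aa (lexx a)) ltxx.
Qed.

Lemma isolated_dually_compact x : dual_algebraic_lattice L ->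
  open [set x] -> dually_compact x.
Proof.
move=> [_ /(_ x)[F [fF Fc Fx]]] xo.
have [f Ff fo] := filtered_inf_eventually fF Fx xo erefl.
by rewrite -(fo f Ff (lexx f)); exact: Fc.
Qed.

(** Zorn's lemma on the interval from [z] to [x], with [x] excluded: isolation
    keeps the suprema of chains inside it. *)
Lemma isolated_maximal_subelement x z : has_all_infimums L ->
  open [set x] -> z < x -> exists2 m, maximal_subelements x m & z <= m.
Proof.
move=> infL xo zx.
pose T := {w : L | (z <= w) && (w < x)}.
have zT : (z <= z) && (z < x) by rewrite lexx.
have [] := @Zorn T (fun u v => sval u <= sval v).
- by move=> t; exact: lexx.
- by move=> r s t; exact: le_trans.
- by move=> s t st ts; apply/val_inj/le_anti; rewrite st ts.
- move=> A Atot; have [[a0 Aa0]|A0] := pselect (A !=set0); last first.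
    by exists (exist _ z zT) => s As; case: A0; exists s.
  have dA : directed [set sval a | a in A].
    split; first by exists (sval a0), a0.
    move=> _ _ [a Aa <-] [b Ab <-].
    by have [ab|ba] := Atot _ _ Aa Ab;
      [exists (sval b); [exists b|]|exists (sval a); [exists a|]].
  have [s sP] := has_all_supremums [set sval a | a in A] infL.
  have sx : s < x.
    apply: isolated_sup xo dA sP _ => _ [a _ <-].
    by have /andP[] := svalP a.
  have zs : z <= s.
    apply: (@le_trans _ _ (sval a0)); first by have /andP[] := svalP a0.
    by apply: sP.1; exists a0.
  have sT : (z <= s) && (s < x) by rewrite zs.
  by exists (exist _ s sT) => a Aa /=; apply: sP.1; exists a.
move=> [m mT] /= mmax; have /andP[zm mx] := mT; exists m => //; split => // w wx mw.
have wT : (z <= w) && (w < x) by rewrite (le_trans zm mw).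
by have /(congr1 sval) := mmax (exist _ w wT) mw.
Qed.

(** The infima of the cofinite parts of the set of maximal subelements tend to
    an element which, if that set is infinite, is below one of them, [m]; the
    coframe law, together with [m `|` w = x] for the others, forbids this. *)
Lemma isolated_finite_maximal x : coframe L ->
  open [set x] -> finite_set (maximal_subelements x).
Proof.
move=> [infL cof] xo; apply: contrapT => Minf.
set M := maximal_subelements x in Minf *.
pose S := [set y | exists2 J, finite_set J & infimums (M `\` J) y].
have [s sP] := has_all_supremums S infL.
have dS : directed S.
  split.
    have [y yP] := infL (M `\` set0).
    by exists y, set0.
  move=> y1 y2 [J1 fJ1 y1P] [J2 fJ2 y2P].
  have [y yP] := infL (M `\` (J1 `|` J2)).
  exists y; first by exists (J1 `|` J2) => //; rewrite finite_setU.
  split; apply: yP.2 => w [Mw Jw].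
    by apply: y1P.1; split => // J1w; apply: Jw; left.
  by apply: y2P.1; split => // J2w; apply: Jw; right.
have sx : s < x.
  apply: isolated_sup xo dS sP _ => y [J fJ yP].
  have [m [Mm Jm]] : M `\` J !=set0.
    exact: infinite_setN0 (infinite_setD Minf fJ).
  by apply: le_lt_trans Mm.1; apply: yP.1.
have [m Mm sm] := isolated_maximal_subelement infL xo sx.
(* the finite set J := [set m] already yields a contradiction *)
have [y yP] := infL (M `\` [set m]).
have ym : y <= m by apply: le_trans sm; apply: sP.1; exists [set m].
have [_ jmax] := cof m _ _ yP.
have : x <= Order.join m y.
  apply: jmax => _ [w [Mw wm] <-].
  have wx : w <= x by case: Mw => /ltW.
  have mx : m <= x by case: Mm => /ltW.
  have jlex : Order.join m w <= x by rewrite leUx mx.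
  apply: contrapT => xj; have jx : Order.join m w < x.
    by rewrite lt_neqAle jlex andbT; apply/eqP => jE; apply: xj; rewrite jE.
  (* m and w are both maximal below x, so m `|` w < x would force m = w *)
  have jm : Order.join m w = m by apply: Mm.2 => //; exact: leUl.
  have jw : Order.join m w = w by apply: Mw.2 => //; exact: leUr.
  by apply: wm; rewrite /= -jm jw.
rewrite (join_l ym) => xm; case: Mm => mx _.
by have := lt_le_trans mx xm; rewrite ltxx.
Qed.

End OrderCompatible.

Theorem theorem5p7 (d : Order.disp_t) (L : latticeTopologicalType d)
    (HL : dual_algebraic_coframe L) (Htau : order_compatible L) (x : L) :
  open [set x] <->
  [/\ dually_compact x,
      ~ (exists z : L, outcast x z) &
      finite_set (maximal_subelements x)].
Proof.
have [daL cofL] := HL; have infL := daL.1; split=> [xo|[xc xout Mfin]].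
  split.
  - exact: isolated_dually_compact.
  - by move=> [z [zx]]; apply; exact: isolated_maximal_subelement.
  - exact: isolated_finite_maximal.
have -> : [set x] = [set z | (z <= x)%O] `\`
    \bigcup_(m in maximal_subelements x) [set z | (z <= m)%O].
  apply/seteqP; split => [_ ->|z [/= zx nM]].
    split; first exact: lexx.
    by move=> [m [/= mx _] /= xm]; have := lt_le_trans mx xm; rewrite ltxx.
  apply: contrapT => /eqP zneq; apply: xout; exists z; split.
    by rewrite lt_neqAle zneq.
  by move=> [m Mm zm]; apply: nM; exists m.
rewrite setDE; apply: openI; first exact: dually_compact_down_open.
apply: closed_openC; apply: closed_bigcup => // m _; exact: closed_down.
Qed.
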